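(* Let $p$ be a prime, $G$ a finite group and $P$ a normal $p$-subgroup of $G$. If every cyclic subgroup of $P$ of prime order or of order $4$ (the latter only when $P$ is not quaternion-free) satisfies partial $\Pi$-property in $G$, then $P\leq Z_{\mathfrak{U}}(G)$.
   Context: All groups are finite. For a positive integer $n$ and a set of primes $\pi$, $n$ is a $\pi$-number if all its prime divisors lie in $\pi$ (so $1$ is a $\pi$-number for every $\pi$, including $\pi=\emptyset$); $\pi(H)$ is the set of prime divisors of $|H|$. Partial $\Pi$-property: a subgroup $H$ of $G$ satisfies partial $\Pi$-property in $G$ if there exists a chief series $1=G_0<G_1<\cdots<G_n=G$ of $G$ such that for every $1\leq i\leq n$, the index $|G/G_{i-1}:N_{G/G_{i-1}}(HG_{i-1}/G_{i-1}\cap G_i/G_{i-1})|$ is a $\pi(HG_{i-1}/G_{i-1}\cap G_i/G_{i-1})$-number. A group is quaternion-free if it has no section isomorphic to the quaternion group of order $8$; thus the condition on cyclic subgroups of order $4$ is imposed only when $p=2$ and $P$ is not quaternion-free. $\mathfrak{U}$ is the class of finite supersolvable groups. A chief factor $L/K$ of $G$ is $\mathfrak{U}$-central in $G$ if $(L/K)\rtimes(G/C_G(L/K))\in\mathfrak{U}$. $Z_{\mathfrak{U}}(G)$, the $\mathfrak{U}$-hypercentre of $G$, is the product of all normal subgroups $N$ of $G$ such that every $G$-chief factor below $N$ is $\mathfrak{U}$-central in $G$. *)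

(* Defs.v *)
From mathcomp Require Import all_boot all_fingroup all_solvable.

Set Implicit Arguments.
Unset Strict Implicit.
Unset Printing Implicit Defensive.

Import GroupScope.

(* In [chief_factor G K L] (MathComp's argument order) the chief factor is
   L / K; a [(G.-chief).-series 1%G s] lists G_1, ..., G_n after G_0 = 1, so
   (K, L) below ranges over the pairs (G_{i-1}, G_i). *)
Definition partial_Pi_property (gT : finGroupType) (G H : {group gT}) : Prop :=
  exists s : seq {group gT},
    [/\ (G.-chief).-series 1%G s, last 1%G s = G
      & forall i : nat, i < size s ->
          let K := nth 1%G (1%G :: s) i in
          let L := nth 1%G s i in
          let X := (H * K / K) :&: (L / K) in
          \pi(X).-nat #|G / K : 'N_(G / K)(X)| ].

Definition quaternion_free (gT : finGroupType) (P : {group gT}) : Prop :=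
  forall H K : {group gT}, H \subset P -> K <| H -> ~ (H / K \isog 'Q_8).

(* There is a chain 1 = H_0 <= ... <= H_n = G of normal subgroups of G whose
   successive quotients are cyclic ([connect] is the boolean existence of a
   path, see [connectP]). *)
Definition supersolvable (gT : finGroupType) (G : {group gT}) : bool :=
  connect [rel K L : {group gT} |
            [&& K <| G, L <| G, K \subset L & cyclic (L / K)]] 1%G G.

Section HyperCenter.

Variables (gT : finGroupType) (G : {group gT}).

Lemma chief_factor_acts (L K : {group gT}) :
  chief_factor G K L ->
  {acts G / 'C_G(L / K | 'Q), on group L / K | 'Q %% 'C_G(L / K | 'Q)}.
Proof.
move=> chLK; have [maxK nsLG] := andP chLK.
have [/andP[/proper_sub sKL nKG] _] := maxgroupP maxK.
have nLG := normal_norm nsLG.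
split; last first.
  rewrite /gacent; apply/subsetP=> x Lx; rewrite inE; apply/andP; split.
    by rewrite (subsetP (quotientS K (subsetT L))).
  apply/afixP=> a; rewrite inE => /andP[_ /setIP[_ Ca]].
  exact: astab_act Lx.
by rewrite astabs_mod ?subsetIr // quotientS // actsQ.
Qed.

(* Chief factors L / K of G, as a finite type of pairs (L, K). *)
Definition chief_factor_of : predArgType :=
  {F : {group gT} * {group gT} | chief_factor G F.2 F.1}.

(* The external semidirect product (L / K) ><| (G / C_G(L / K)) for the
   action induced by conjugation. *)
Definition chief_factor_sdprod (F : chief_factor_of) : finGroupType :=
  sdprod_by (<[chief_factor_acts (valP F)]>)%gact.

Definition U_central (F : chief_factor_of) : bool :=
  supersolvable [set: chief_factor_sdprod F]%G.

Definition U_hypercenter : {group gT} :=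
  (\prod_(N : {group gT} | (N <| G) &&
      [forall F : chief_factor_of, ((val F).1 \subset N) ==> U_central F]) N)%G.

End HyperCenter.

(* Main.v *)
Require Import Defs.
From mathcomp Require Import all_boot all_fingroup all_algebra all_solvable all_field all_character.

Import GRing.Theory GroupScope.

Set Implicit Arguments.
Unset Strict Implicit.

(* Let [D] be generated by the commutators and the (p-1)-th powers of [G], and
   [E] by the p'-elements of [D]. If [E] centralises [P] then [D] acts on each
   chief factor of [G] below [P] as a p-group, hence trivially, so [G] acts as an
   abelian group of exponent dividing [p - 1]; such an irreducible action is by
   scalars and the factor has order [p].
   To see that [E] centralises [P], take [P] minimal and assume it does not.
   Then [N = 'C_P(E)] is the largest proper [G]-invariant subgroup of [P], and
   [[~: P, E] = P], so [N] is central in [P] by the three subgroup lemma. A power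
   map that is a morphism from [P] to [N] is [E]-invariant, hence trivial; so [P]
   has exponent [p], or exponent dividing 4 when [p = 2], and in the latter case
   [P] is elementary abelian if it is quaternion-free. Now take [x] in [P] outside
   [N] and central modulo [N] in a Sylow p-subgroup [S]. By the partial
   Pi-property [<[x]> N] is normalised by a subgroup of p-power index as well as
   by [S], so it is normal in [G] and equals [P]. But then [P / N] has order [p]
   and is centralised by [D], contradicting [[~: P, E] = P]. *)


(** * Invariant maps and quaternion subgroups *)

(** [P] is generated by the elements [[~ x, e] = x^-1 * x ^ e], and an invariant morphism kills each
    of them. *)
Lemma invariant_morph_trivial (gT rT : finGroupType) (P E : {group gT})
    (f : gT -> rT) :
  {in P &, {morph f : x y / x * y}} -> [~: P, E] = P ->
  {in P & E, forall x e, f (x ^ e) = f x} -> {in P, forall x, f x = 1}.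
Proof.
move=> fM defP fJ; pose g := Morphism fM.
suff sPK : P \subset 'ker g by move=> x /(subsetP sPK)/mker.
have nPE : E \subset 'N(P) by rewrite -commg_subl defP.
rewrite -{1}defP gen_subG; apply/subsetP=> _ /imset2P[x e Px Ee ->].
have Pxe : x ^ e \in P by rewrite memJ_norm ?(subsetP nPE).
rewrite commgEl; apply/kerP; first by rewrite groupM ?groupV.
by rewrite morphM ?groupV // morphV //= fJ // mulVg.
Qed.

(** As [e] commutes with [c = [~ x, e]], [c ^+ #[e] = [~ x, e ^+ #[e]] = 1], so the order of [c]
    divides [#[e]]. *)
Lemma coprime_commg_eq1 (gT : finGroupType) (x e : gT) :
  commute e [~ x, e] -> coprime #[[~ x, e]] #[e] -> [~ x, e] = 1.
Proof.
move=> cee co; apply/eqP; rewrite -order_eq1 -dvdn1 -(eqP co) dvdn_gcd dvdnn.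
by rewrite order_dvdn -commgX // expg_order commg1 eqxx.
Qed.

(** The defining relations of ['Q_8] hold, so the order divides 8; it exceeds 4 because [y], not
    commuting with [x], lies outside [<[x]>]. *)
Lemma Q8_isog (gT : finGroupType) (x y z : gT) :
    z != 1 -> z ^+ 2 = 1 -> x ^+ 2 = z -> y ^+ 2 = z -> [~ x, y] = z ->
  <<[set x; y]>> \isog 'Q_8.
Proof.
move=> ntz z2 x2 y2 xy.
have x4 : x ^+ 4 = 1 by rewrite (expgM x 2 2) x2.
have xJy : x ^ y = x^-1.
  by apply: (mulgI x^-1); rewrite -commgEl xy -invMg -expg2 x2; apply/esym/eqP;
     rewrite eq_invg_mul -expg2 z2.
have isoQ := Grp_quaternion (isT : 2 < 3).
apply/(isoGrpP _ isoQ).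
have homH : <<[set x; y]>> \homg
    Grp (x : y : x ^+ (2 ^ 2), y ^+ 2 = x ^+ (2 ^ 1), x ^ y = x^-1).
  apply/existsP; exists (x, y) => /=.
  by rewrite joing_idl joing_idr x4 x2 y2 xJy !eqxx.
split=> //; rewrite card_quaternion //.
have: #|<<[set x; y]>>| %| 8.
  by rewrite -[8]/(2 ^ 3)%N -(card_quaternion (isT : 2 < 3)) card_homg ?isoQ.
have ox : #[x] = 4 by rewrite (@orderXprime _ 2 2) // x2 (nt_prime_order _ z2).
have nxy : y \notin <[x]>.
  by apply: contra ntz => /cycleP[i yE]; rewrite -xy yE commgXg.
have : #|<[x]>| < #|<<[set x; y]>>|.
  apply/proper_card/properP; split.
    by rewrite cycle_subG mem_gen // !inE eqxx.
  by exists y => //; rewrite mem_gen // !inE eqxx orbT.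
rewrite -orderE ox -[8]/(2 ^ 3)%N => lt4 /(dvdn_pfactor _ 3 (isT : prime 2))[m].
by move=> lem3 oH; move: lt4; rewrite oH; case: m lem3 {oH} => [|[|[|[|]]]].
Qed.


(* If [Q] has no such subgroup, all elements with square [z] have the same
   commutator map [y |-> [~ x, y]] into [<[z]>]; that map is then
   [E]-invariant, hence trivial on [[~: Q, E] = Q]. *)
Lemma Q8_sub_exists (gT : finGroupType) (Q E : {group gT}) (z : gT) :
    z ^+ 2 = 1 -> Q \subset 'C[z] -> E \subset 'C[z] ->
    {in Q, forall x, x ^+ 2 \in <[z]>} ->
    {in Q &, forall x y, [~ x, y] \in <[z]>} ->
    [~: Q, E] = Q -> ~~ abelian Q ->
  exists2 H : {group gT}, H \subset Q & H \isog 'Q_8.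
Proof.
move=> z2 cQz cEz sqQ cmQ defQ nabQ.
have nQE : E \subset 'N(Q) by rewrite -commg_subl defQ.
have zP w : w \in <[z]> -> w = 1 \/ w = z.
  case/cycleP=> i ->; rewrite -(odd_double_half i) expgD -muln2 mulnC expgM z2.
  by rewrite expg1n mulg1; case: (odd i); [right | left].
have [z1 | ntz] := eqVneq z 1.
  case/negP: nabQ; apply/centsP=> x Qx y Qy; apply/commgP.
  by have [->|->] := zP _ (cmQ x y Qx Qy); rewrite ?z1.
have tM v w : v \in <[z]> -> w \in <[z]> ->
    (v * w != 1) = (v != 1) (+) (w != 1).
  move=> /zP[]-> /zP[]->; rewrite ?mul1g ?mulg1 ?eqxx ?(negPf ntz) //.
  by rewrite -expg2 z2 eqxx.
have Cz w x : x \in Q -> w \in <[z]> -> commute x w.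
  move=> Qx /cycleP[i ->]; apply: commuteX.
  by apply/cent1P; apply: (subsetP cQz).
pose q (x : gT) := x ^+ 2 != 1; pose b (x y : gT) := [~ x, y] != 1.
have bC x y : b x y = b y x by rewrite /b -invg_comm eq_invg1.
have bM x y w : x \in Q -> y \in Q -> w \in Q -> b w (x * y) = b w x (+) b w y.
  move=> Qx Qy Qw; rewrite /b commgMJ conjgE -(Cz [~ w, x]) ?cmQ // mulKg.
  by rewrite tM ?cmQ // addbC.
have qM x y : x \in Q -> y \in Q -> q (x * y) = q x (+) q y (+) b x y.
  move=> Qx Qy; rewrite bC /q /b expMg_Rmul; try by apply: Cz; rewrite ?cmQ.
  by rewrite binn expg1 tM ?cmQ //; [rewrite tM ?sqQ | apply: groupM; apply: sqQ].
have [[u [v [Qu Qv [qu qv buv]]]]|noQ8] :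
    (exists x y, [/\ x \in Q, y \in Q & [/\ q x, q y & b x y]]) \/
    (forall x y, x \in Q -> y \in Q -> q x -> q y -> b x y = false).
  case: (boolP [exists x in Q, exists y in Q, [&& q x, q y & b x y]]).
    by case/exists_inP=> x Qx /exists_inP[y Qy /and3P[]]; left; exists x, y.
  rewrite negb_exists_in => /forall_inP no8; right=> x y Qx Qy qx qy.
  have := no8 x Qx; rewrite negb_exists_in => /forall_inP/(_ y Qy).
  by rewrite qx qy => /negPf.
- exists <<[set u; v]>>%G; first by rewrite gen_subG subUset !sub1set Qu.
  apply: (@Q8_isog _ _ _ z) => //.
  + by move: qu; rewrite /q; have [->|//] := zP _ (sqQ _ Qu); rewrite eqxx.
  + by move: qv; rewrite /q; have [->|//] := zP _ (sqQ _ Qv); rewrite eqxx.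
  by move: buv; rewrite /b; have [->|//] := zP _ (cmQ _ _ Qu Qv); rewrite eqxx.
(* If [b x w] held without [b x' w], then [s = w * (x * x')] would satisfy [q s] and [b x s],
   against [noQ8]. *)
have bS x x' w : x \in Q -> x' \in Q -> w \in Q -> q x -> q x' -> b x w -> b x' w.
  move=> Qx Qx' Qw qx qx' bxw; case bx'w: (b x' w) => //.
  have qw : q w = false.
    by apply: contraTF bxw => qw; rewrite noQ8.
  have bxx' : b x x' = false by rewrite noQ8.
  have qs : q (w * (x * x')).
    by rewrite !qM ?bM ?groupM // qx qx' qw bxx' (bC w) (bC w) bxw bx'w.
  have := noQ8 _ _ Qx (groupM Qw (groupM Qx Qx')) qx qs.
  by rewrite !bM ?groupM // bxw bxx' /b commgg eqxx.
have [x [w [Qx Qw [qx bxw]]]] :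
    exists x w, [/\ x \in Q, w \in Q & q x /\ b x w].
  have [x0 Qx0 [y0 Qy0 bxy]] : exists2 x0, x0 \in Q & exists2 y0, y0 \in Q & b x0 y0.
    move: nabQ; rewrite /abelian => /subsetPn[x0 Qx0 nCx0]; exists x0 => //.
    have [y0 Qy0 nC] : exists2 y0, y0 \in Q & b x0 y0; last by exists y0.
    apply/exists_inP; apply: contraR nCx0; rewrite negb_exists_in => /forall_inP cx.
    by apply/centP=> y0 /cx; rewrite negbK => /commgP.
  have [qx0|nqx0] := boolP (q x0); first by exists x0, y0.
  have [qy0|nqy0] := boolP (q y0); first by exists y0, x0; rewrite bC.
  (* When [q] fails at [x0] and [y0], it holds at [x0 * y0], since [b x0 y0] does. *)
  exists (x0 * y0), y0; split; rewrite ?groupM // qM // (negPf nqx0) (negPf nqy0).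
  by rewrite bxy (bC _ y0) bM // bC bxy /b commgg eqxx.
have QJ u e : e \in E -> u \in Q -> u ^ e \in Q.
  by move=> Ee Qu; rewrite memJ_norm ?(subsetP nQE).
have zJ u e : e \in E -> u \in <[z]> -> u ^ e = u.
  move=> Ee /cycleP[i ->]; apply/conjg_fixP/commgP/commute_sym/commuteX.
  by apply/cent1P; apply: (subsetP cEz).
case/negP: bxw; apply/eqP.
apply: (@invariant_morph_trivial _ _ Q E (fun w => [~ x, w])) => //.
- by move=> u v Qu Qv; rewrite /= commgMJ conjgE -(Cz [~ x, u]) ?cmQ // mulKg (Cz [~ x, u]) ?cmQ ?groupR.
move=> u e Qu Ee /=.
(* [q] holds at both [x] and [x ^ e], so [bS] equates their commutator maps; as [e] fixes [<[z]>],
   [b x (u ^ e) = b (x ^ e) (u ^ e) = b x u]. *)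
have qxe : q (x ^ e) by rewrite /q -conjXg zJ ?sqQ.
have bE : b x (u ^ e) = b x u.
  have bJ : b (x ^ e) (u ^ e) = b x u by rewrite /b -conjRg zJ ?cmQ.
  by rewrite -bJ; apply/idP/idP; apply: bS; rewrite ?QJ.
move: bE; rewrite /b.
by have [->|->] := zP _ (cmQ _ _ Qx (QJ _ _ Ee Qu));
   have [->|->] := zP _ (cmQ _ _ Qx Qu); rewrite // eqxx (negPf ntz).
Qed.


(** * Exponent and commutativity of [P] *)

(** In class at most 2, [(x * y) ^+ n = x ^+ n * y ^+ n * [~ y, x] ^+ 'C(n, 2)], and [[~ y, x] ^+ p
    = [~ y ^+ p, x] = 1]. So the power map is a morphism into [N], which [E] fixes pointwise. The
    uses are [n = p] odd, [n = 4] with [p = 2], and [n = p = 2] with [P] abelian. *)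
Lemma class2_expg_eq1 (gT : finGroupType) (p n : nat) (P E N : {group gT}) :
    [~: P, E] = P -> N \subset 'Z(P) -> E \subset 'C(N) ->
    P^`(1) \subset N -> {in P, forall x, x ^+ p \in N} ->
    p %| n -> abelian P \/ p %| 'C(n, 2) ->
  {in P, forall x, x ^+ n = 1}.
Proof.
move=> defP sNZ cNE sP'N powN /dvdnP[m ->] abel_or.
have nPE : E \subset 'N(P) by rewrite -commg_subl defP.
have cN x y : x \in P -> y \in N -> commute x y.
  by move=> Px /(subsetP sNZ)/centerP[_ cy]; apply/commute_sym/cy.
have cR x y w : x \in P -> y \in P -> w \in P -> commute w [~ x, y].
  by move=> Px Py Pw; apply: cN => //; rewrite (subsetP sP'N) ?mem_commg.
apply: (@invariant_morph_trivial _ _ P E) => // [x y Px Py|x e Px Ee].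
  rewrite expMg_Rmul; try by apply: cR.
  suff -> : [~ y, x] ^+ 'C(m * p, 2) = 1 by rewrite mulg1.
  case: abel_or => [/centsP cPP|/dvdnP[k ->]].
    by have /commgP/eqP-> := cPP y Py x Px; rewrite expg1n.
  rewrite mulnC expgM -commXg; last exact: cR.
  by have /commgP/eqP-> := commute_sym (cN x (y ^+ p) Px (powN y Py)); rewrite expg1n.
rewrite -conjXg; apply/conjg_fixP/commgP/commute_sym.
have Nx : x ^+ (m * p) \in N by rewrite mulnC expgM groupX ?powN.
exact: (centsP cNE).
Qed.

Lemma quaternion_free_abelian (gT : finGroupType) (P E N : {group gT}) :
    2.-group P -> [~: P, E] = P -> N \subset 'Z(P) -> E \subset 'C(N) ->
    P^`(1) \subset N -> {in P, forall x, x ^+ 2 \in N} ->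
  quaternion_free P -> abelian P.
Proof.
move=> pP defP sNZ cNE sP'N sqN qfP; apply/idPn=> nabP.
have [sNP cNP] : N \subset P /\ P \subset 'C(N).
  by rewrite centsC; apply/andP; rewrite -subsetI.
have x4 : {in P, forall x, x ^+ 4 = 1}.
  by apply: (@class2_expg_eq1 _ 2 4 P E N) => //; right.
have pN := pgroupS sNP pP.
have sWN : 'Ohm_1(N) \subset N := Ohm_sub 1 N.
have abelW : 2.-abelem 'Ohm_1(N).
  by rewrite Ohm1_abelem // /abelian (subset_trans sNP).
have Wsq x : x \in P -> x ^+ 2 \in 'Ohm_1(N).
  move=> Px; rewrite (OhmE 1 pN) mem_gen //; apply/LdivP.
  by rewrite -expgM x4 ?sqN.
have WR x y : x \in P -> y \in P -> [~ x, y] \in 'Ohm_1(N).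
  move=> Px Py.
  have -> : [~ x, y] = (x ^+ 2)^-1 * (x * y^-1) ^+ 2 * y ^+ 2.
    by rewrite !expgS !expg0 !mulg1 invMg !mulgA mulgKV mulgKV commgEl conjgE !mulgA.
  apply: groupM; [apply: groupM; [rewrite groupV|]|]; apply: Wsq => //.
  by rewrite groupM ?groupV.
have [a [b [Pa Pb ntz]]] : exists a b, [/\ a \in P, b \in P & [~ a, b] != 1].
  move: nabP; rewrite /abelian => /subsetPn[a Pa nCa]; exists a.
  have [b Pb nC] : exists2 b, b \in P & [~ a, b] != 1; last by exists b.
  apply/exists_inP; apply: contraR nCa; rewrite negb_exists_in => /forall_inP ca.
  by apply/centP=> b /ca; rewrite negbK => /commgP.
set z := [~ a, b] in ntz.
have Wz : z \in 'Ohm_1(N) by apply: WR.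
have szW : <[z]> \subset 'Ohm_1(N) by rewrite cycle_subG.
(* Factoring out a complement [M] of [<[z]>] in ['Ohm_1(N)] puts all squares and commutators into
   the image of [<[z]>] while keeping [z = [~ a, b]] nontrivial, as [Q8_sub_exists] requires. *)
have [M defW] := abelem_split_dprod abelW szW.
have [_ mulzM _ tizM] := dprodP defW.
have sMN : M \subset N by rewrite (subset_trans _ sWN) // -mulzM mulG_subr.
have nMP : P \subset 'N(M) by rewrite cents_norm // (subset_trans cNP) ?centS.
have nME : E \subset 'N(M) by rewrite cents_norm // (subset_trans cNE) ?centS.
have Nz : z \in N by apply: (subsetP sWN).
have z2 : z ^+ 2 = 1 by have [_ ->] := abelemP (isT : prime 2) abelW.
have cosW w : w \in 'Ohm_1(N) -> coset M w \in <[coset M z]>.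
  rewrite -mulzM => /mulsgP[u m zu Mm ->].
  have nMz : z \in 'N(M) by rewrite (subsetP nMP) ?(subsetP sNP).
  rewrite morphM ?(subsetP (normG M) m) //=; last first.
    by apply: subsetP zu; rewrite cycle_subG.
  rewrite (coset_id Mm) mulg1; case/cycleP: zu => i ->.
  by rewrite morphX // mem_cycle.
have nP x : x \in P -> x \in 'N(M) by apply: (subsetP nMP).
have [H sHQ isoH] : exists2 H : {group coset_of M}, H \subset P / M & H \isog 'Q_8.
  apply: (@Q8_sub_exists _ (P / M) (E / M) (coset M z)).
  - by rewrite -morphX ?nP ?(subsetP sNP) // z2 morph1.
  - by rewrite (subset_trans (quotient_cents M cNP)) // -cent_set1 centS ?sub1set ?mem_quotient.
  - by rewrite (subset_trans (quotient_cents M cNE)) // -cent_set1 centS ?sub1set ?mem_quotient.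
  - move=> _ /morphimP[x _ Px ->]; rewrite -morphX ?nP //; exact/cosW/Wsq.
  - move=> _ _ /morphimP[x _ Px ->] /morphimP[y _ Py ->].
    by rewrite -morphR ?nP //; apply/cosW/WR.
  - by rewrite -quotientR // defP.
  apply: contra ntz => cPM; rewrite -in_set1 -[[set 1]]tizM inE cycle_id.
  by move: cPM; rewrite /abelian quotient_cents2 // => /subsetP-> //; apply: mem_commg.
have nsMP : M <| P by rewrite /normal (subset_trans sMN sNP).
case: (inv_quotientS nsMP sHQ) isoH => K -> sMK sKP isoH.
by apply: (qfP K M sKP _ isoH); rewrite /normal sMK (subset_trans sKP).
Qed.


(** * Irreducible abelian actions of exponent dividing [p - 1] *)

(* The product of all [rG x - a], [a] in [F], is [rG x ^+ #|F| - rG x = 0], so by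
   Schur's lemma one of the factors vanishes. *)
Lemma irr_scalar_dim1 (F : finFieldType) (gT : finGroupType) (G : {group gT})
    (n : nat) (rG : mx_representation F G n) :
    mx_irreducible rG ->
    {in G &, forall x y, rG x *m rG y = rG y *m rG x}%R ->
    {in G, forall x, rG (x ^+ #|F|.-1) = 1%:M%R} ->
  n = 1%N.
Proof.
case: n rG => [|n] rG irrG cG expG; first by have [] := (mx_irrP _).1 irrG.
have scalG x : x \in G -> exists a, rG x = a%:M%R.
  move=> Gx; have: horner_mx (rG x) ('X^#|F| - 'X)%R = 0%R.
    rewrite rmorphB rmorphXn /= horner_mx_X -(prednK (ltnW (finNzRing_gt1 F))).
    by rewrite exprS -repr_mxX // expG // mulr1 subrr.
  rewrite finField_genPoly rmorph_prod => prod0.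
  have [a] : exists a, (horner_mx (rG x) ('X - a%:P) == 0)%R.
    apply/existsP/contraT; rewrite negb_exists => /forallP nz.
    suff: (\prod_a horner_mx (rG x) ('X - a%:P) \is a GRing.unit)%R.
      by rewrite prod0 unitr0.
    apply: rpred_prod => a _; apply: (mx_Schur irrG) (nz a).
    apply/centgmxP=> y Gy; rewrite rmorphB /= horner_mx_X horner_mx_C.
    by rewrite mulmxBl mulmxBr cG // scalar_mxC.
  rewrite rmorphB /= horner_mx_X horner_mx_C subr_eq0 => /eqP; by exists a.
(* Scalars preserve every subspace, so the line spanned by a matrix unit is a submodule, hence the
   whole space. *)
have [_ /(_ (delta_mx 0%R 0%R))] := (mx_irrP _).1 irrG.
rewrite /row_full mxrank_delta => /(_ _ _)/eqP <- //.
  by apply/mxmoduleP=> x /scalG[a ->]; rewrite mul_mx_scalar scalemx_sub.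
by rewrite -mxrank_eq0 mxrank_delta.
Qed.

(** [V] is elementary abelian, hence an irreducible module over ['F_p], on which [G] acts by
    commuting matrices whose [(p - 1)]-th power is 1. *)
Lemma minnormal_scalar_prime (gT : finGroupType) (p : nat) (G V : {group gT}) :
    minnormal V G -> p.-group V -> [~: G, G] \subset 'C(V) ->
    {in G, forall x, x ^+ p.-1 \in 'C(V)} ->
  prime #|V|.
Proof.
move=> minV pV cGV powG.
have [nVG ntV abV] := minnormal_solvable minV (subxx V) (pgroup_sol pV).
have [p_pr _ _] := pgroup_pdiv pV ntV.
have abelV : p.-abelem V by rewrite -is_abelem_pgroup.
pose rG := abelem_repr abelV ntV nVG.
have irrG : mx_irreducible rG by apply/abelem_mx_irrP.
have kerG x : x \in G -> x \in 'C(V) -> rG x = 1%:M%R.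
  move=> Gx Cx; have : x \in 'C_G(V) by rewrite inE Gx.
  by rewrite -(rker_abelem abelV ntV nVG) => /rkerP[].
have: 'dim V = 1%N.
  apply: (@irr_scalar_dim1 'F_p _ G _ rG irrG) => [x y Gx Gy | x Gx].
    have GR : [~ x, y] \in G by rewrite groupR.
    have Gyx : y * x \in G by rewrite groupM.
    rewrite -!repr_mxM // [x * y]commgC (repr_mxM rG Gyx GR) (kerG _ GR) ?mulmx1 //.
    by rewrite (subsetP cGV) ?mem_commg.
  by rewrite card_Fp //; apply: kerG; [rewrite groupX | apply: powG].
by move=> dV; rewrite (card_pgroup pV) -(dim_abelemE abelV ntV) dV expn1.
Qed.


(** * U-centrality of chief factors of prime order *)

Lemma cyclic_quo_astabQ (gT : finGroupType) (G K L : {group gT}) :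
    K <| G -> L <| G -> K \subset L -> prime #|L / K| ->
  cyclic (G / 'C_G(L / K | 'Q)).
Proof.
move=> nsKG nsLG sKL pr; have [[sLG nLG] [_ nKG]] := (andP nsLG, andP nsKG).
have nVG : G / K \subset 'N(L / K) by rewrite quotient_norms.
have nsCG : 'C_G(L / K | 'Q) <| G.
  apply: normalGI (astab_normal 'Q (L / K)).
  by rewrite /= astabsQ ?(normalS sKL sLG) // subsetI nKG.
have sKC : K \subset 'C_G(L / K | 'Q).
  by rewrite subsetI normal_sub // sub_astabQ ?normG ?trivg_quotient ?sub1G.
rewrite -(isog_cyclic (third_isog sKC nsKG nsCG)) /= astabQ quotient_setIpre.
have := first_isog_loc (conj_aut_morphism (L / K)) nVG; rewrite ker_conj_aut.
move/isog_cyclic->; exact: cyclicS (Aut_conj_aut _ _) (Aut_prime_cyclic pr).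
Qed.

(** In the semidirect product, the base [L / K] is cyclic of prime order and the quotient embeds in
    its cyclic automorphism group. *)
Lemma U_central_prime (gT : finGroupType) (G : {group gT}) (F : chief_factor_of G) :
  prime #|(val F).1 / (val F).2| -> U_central F.
Proof.
case: F => [[L K] /= chLK] pr.
have [maxK nsLG] := andP chLK.
have [/andP[/proper_sub sKL nKG] _] := maxgroupP maxK.
have nsKG : K <| G by rewrite /normal nKG (subset_trans sKL) ?normal_sub.
rewrite /U_central /supersolvable.
pose F : chief_factor_of G := exist _ (L, K) chLK.
pose to := (<[chief_factor_acts (valP F)]>)%gact.
have defT := sdprod_sdpair to.
have [nsAT _ _ _ _] := sdprod_context defT.
apply: (@connect_trans _ _ (sdpair1 to @* (L / K))%G); apply: connect1 => /=.
  rewrite normal1 nsAT sub1G -(isog_cyclic (quotient1_isog _)).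
  by rewrite morphim_cyclic ?prime_cyclic.
rewrite normal_refl nsAT normal_sub //= -(isog_cyclic (sdprod_isog defT)).
by rewrite morphim_cyclic // cyclic_quo_astabQ.
Qed.


(** * The residual subgroups [D] and [E] *)

(** For [pi = p^'] this is the p-residual of [G], its least normal subgroup with p-group
    quotient. *)
Definition pi_elt_gen {gT : finGroupType} (pi : nat_pred) (G : {group gT}) :=
  <<[set x in G | pi.-elt x]>>%G.

(** The least normal subgroup whose quotient is abelian of exponent dividing [n]. *)
Definition abelian_exp_res {gT : finGroupType} (n : nat) (G : {group gT}) :=
  ([~: G, G] <*> <<[set x ^+ n | x in G]>>)%G.

Lemma pi_elt_gen_sub (gT : finGroupType) (pi : nat_pred) (D : {group gT}) : pi_elt_gen pi D \subset D.
Proof. by rewrite gen_subG; apply/subsetP=> x /[!inE]/andP[]. Qed.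

Lemma pi_elt_gen_normal (gT : finGroupType) (pi : nat_pred) (G D : {group gT}) :
    D <| G -> pi_elt_gen pi D <| G.
Proof.
case/andP=> sDG nDG; rewrite /normal (subset_trans (pi_elt_gen_sub _ _)) //.
apply: subset_trans (norm_gen _); apply/subsetP=> g Gg; rewrite inE.
apply/subsetP=> _ /imsetP[x + ->]; rewrite !inE p_eltJ => /andP[Dx ->].
by rewrite memJ_norm ?Dx ?(subsetP nDG).
Qed.

Lemma abelian_exp_res_normal (gT : finGroupType) (n : nat) (G : {group gT}) :
  abelian_exp_res n G <| G.
Proof.
rewrite /normal join_subG commg_subl normG gen_subG /=; apply/andP; split.
  by apply/subsetP=> _ /imsetP[x Gx ->]; apply: groupX.
rewrite normsY ?normsR ?normG //.
apply: subset_trans (norm_gen _); apply/subsetP=> g Gg; rewrite inE.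
apply/subsetP=> _ /imsetP[_ /imsetP[x Gx ->] ->].
by rewrite conjXg; apply/imset_f/groupJ.
Qed.

(** For a p'-element [e] of [D] and [x] in [P], [[~ x, e]] is a p-element commuting with [e], so
    [coprime_commg_eq1] applies. *)
Lemma pgroup_cent_pi_elt_gen (gT : finGroupType) (p : nat) (D P : {group gT}) :
    let E := pi_elt_gen p^' D in
  p.-group P -> E \subset 'N(P) -> [~: P, E] \subset 'C(E) -> P \subset 'C(E).
Proof.
move=> E pP nPE cRE; rewrite centsC gen_subG; apply/subsetP=> e De.
have Ee : e \in E by rewrite mem_gen.
have p'e : p^'.-elt e by move: De; rewrite inE => /andP[].
apply/centP=> x Px; apply/commute_sym/commgP/eqP.
have Rxe : [~ x, e] \in [~: P, E] by rewrite mem_commg.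
have Pxe : [~ x, e] \in P.
  by move: Rxe; apply/subsetP; rewrite commg_subl.
apply: coprime_commg_eq1; first exact/commute_sym/(centsP cRE)/Ee.
exact: pnat_coprime (mem_p_elt pP Pxe) p'e.
Qed.

Lemma Sylow_index_sub (gT : finGroupType) (p : nat) (G S H : {group gT}) :
  p.-Sylow(G) S -> S \subset H -> p.-nat #|G : H| -> G \subset H.
Proof.
move=> sylS sSH pGH; have [sSG _ p'GS] := and3P sylS.
rewrite -indexg_eq1; apply/eqP/(pnat_1 pGH).
exact: pnat_dvd (indexgS G sSH) p'GS.
Qed.

(** For a prime [q] other than [p], Sylow q-subgroups of [G] consist of p'-elements, so [q] does not
    divide the index of the join. *)
Lemma Sylow_join_pi_elt_gen (gT : finGroupType) (p : nat) (G S : {group gT}) :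
  p.-Sylow(G) S -> G \subset S <*> pi_elt_gen p^' G.
Proof.
move=> sylS; apply: (@Sylow_index_sub _ p G S (S <*> pi_elt_gen p^' G)%G sylS (joing_subl _ _)).
apply/pnatP=> // q q_pr; apply: contraLR => p'q.
have [Q sylQ] := Sylow_exists q G; have [sQG qQ q'GQ] := and3P sylQ.
rewrite -p'natE //; apply: pnat_dvd q'GQ; apply: indexgS.
apply: subset_trans (joing_subr _ _); apply/subsetP=> x Qx.
rewrite mem_gen // inE (subsetP sQG) //=.
exact: (@pi_pnat p^' q #[x] (mem_p_elt qQ Qx) p'q).
Qed.


(** * Chief factors below [P] when [E] centralises [P] *)

Lemma centralised_chief_factor_prime (gT : finGroupType) (p : nat)
    (G P K L : {group gT}) :
    let D := abelian_exp_res p.-1 G in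
    prime p -> p.-group P -> P \subset 'C(pi_elt_gen p^' D) ->
    chief_factor G K L -> L \subset P ->
  prime #|L / K|.
Proof.
move=> D p_pr pP cPE chKL sLP.
have [maxK nsLG] := andP chKL; have [sLG nLG] := andP nsLG.
have [/andP[/proper_sub sKL nKG] _] := maxgroupP maxK.
have minV := chief_factor_minnormal chKL.
have pL := pgroupS sLP pP.
have [sDG nDG] := andP (abelian_exp_res_normal p.-1 G).
have [S sylS] := Sylow_exists p D; have [sSD pS _] := and3P sylS.
have nLS : S \subset 'N(L) by rewrite (subset_trans sSD) ?(subset_trans sDG).
have pLS : p.-group (L <*> S) by rewrite norm_joinEr // pgroupM pL.
have nKLS : L <*> S \subset 'N(K).
  by rewrite (subset_trans _ nKG) // join_subG sLG (subset_trans sSD).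
have ntV : L / K != 1 by have /andP[] := mingroupp minV.
(* [D] is generated by [S] and by p'-elements centralising [L], so it suffices that [L / K] meets
   the centre of the p-group [(L <*> S) / K]. *)
have ntC : 'C_(L / K)(D / K) != 1.
  have nsV : L / K <| (L <*> S) / K by rewrite quotient_normal // normalYl.
  have := meet_center_nil (pgroup_nil (quotient_pgroup K pLS)) nsV ntV.
  apply: contraNneq => C1; rewrite -subG1 -C1 subsetI subsetIl /=.
  have sDSE : D \subset S <*> pi_elt_gen p^' D by apply: Sylow_join_pi_elt_gen.
  rewrite centsC (subset_trans (quotientS K sDSE)) //.
  rewrite quotientY ?(subset_trans sSD) ?(subset_trans sDG) //; last first.
    by rewrite (subset_trans (pi_elt_gen_sub _ _)) ?(subset_trans sDG).
  rewrite join_subG; apply/andP; split.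
    rewrite centsC (subset_trans (subsetIr _ _)) // (subset_trans (subsetIr _ _)) //.
    by rewrite centS // quotientS ?joing_subr.
  apply: subset_trans (centS (subsetIl _ _)); apply: quotient_cents.
  by rewrite centsC (subset_trans sLP).
have cDV : D / K \subset 'C(L / K).
  have /mingroupP[_ /(_ ('C_(L / K)(D / K))%G)] := minV.
  rewrite centsC => <-; rewrite ?subsetIr ?subsetIl //.
  by rewrite ntC normsI ?norms_cent ?quotient_norms.
apply: (@minnormal_scalar_prime _ p (G / K)%G (L / K)%G) => //.
- exact: quotient_pgroup.
- by rewrite -quotientR // (subset_trans _ cDV) // quotientS ?joing_subl.
move=> _ /morphimP[x Nx Gx ->]; rewrite -morphX //= (subsetP cDV) //.
apply/mem_quotient/(subsetP (joing_subr _ _))/mem_gen/imset_f.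
exact: Gx.
Qed.

Lemma sub_U_hypercenter (gT : finGroupType) (p : nat) (G P : {group gT}) :
    prime p -> P <| G -> p.-group P ->
    P \subset 'C(pi_elt_gen p^' (abelian_exp_res p.-1 G)) ->
  P \subset U_hypercenter G.
Proof.
move=> p_pr nsPG pP cPE; rewrite /U_hypercenter bigprodGE sub_gen //.
apply: bigcup_sup => //; rewrite nsPG; apply/forallP=> F; apply/implyP=> sLP.
exact/U_central_prime/(centralised_chief_factor_prime p_pr pP cPE (valP F)).
Qed.


(** * The partial Pi-property forces [E] to centralise [P] *)

(** [Aut (L / K)] is cyclic of order [p - 1], so commutators and [(p - 1)]-th powers act trivially
    on [L / K]. *)
Lemma abelian_exp_res_cent_prime (gT : finGroupType) (p : nat) (G K L : {group gT}) :
    K <| G -> L <| G -> prime p -> #|L / K| = p ->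
  abelian_exp_res p.-1 G / K \subset 'C(L / K).
Proof.
move=> nsKG nsLG p_pr oV; have [[_ nLG] [_ nKG]] := (andP nsLG, andP nsKG).
have nVG : G / K \subset 'N(L / K) by rewrite quotient_norms.
have prV : prime #|L / K| by rewrite oV.
have oA : #|Aut (L / K)| = p.-1 by rewrite card_Aut_cyclic ?prime_cyclic // oV totient_prime.
have cAA := cyclic_abelian (Aut_prime_cyclic prV).
have fA x : x \in G -> conj_aut (L / K) (coset K x) \in Aut (L / K).
  move=> Gx; apply: (subsetP (Aut_conj_aut _ (G / K))).
  by rewrite mem_morphim ?mem_quotient // (subsetP nVG) ?mem_quotient.
have nV x : x \in G -> coset K x \in 'N(L / K).
  by move=> Gx; rewrite (subsetP nVG) ?mem_quotient.
have nK x : x \in G -> x \in 'N(K) by apply: (subsetP nKG).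
have memC x : x \in 'N(L / K) -> conj_aut (L / K) x = 1 -> x \in 'C(L / K).
  by move=> nx fx; rewrite -ker_conj_aut; apply/kerP.
suff: abelian_exp_res p.-1 G \subset 'C(L / K | 'Q) by rewrite sub_astabQ => /andP[].
rewrite join_subG !gen_subG /= astabQ; apply/andP; split; apply/subsetP.
  move=> _ /imset2P[x y Gx Gy ->]; rewrite mem_morphpre ?groupR ?nK // morphR ?nK //.
  apply: memC; first by rewrite groupR ?nV.
  by rewrite morphR ?nV //; apply/eqP/commgP/(centsP cAA); apply: fA.
move=> _ /imsetP[x Gx ->]; rewrite mem_morphpre ?groupX ?nK // morphX ?nK //.
apply: memC; first by rewrite groupX ?nV.
by rewrite morphX ?nV //; apply/eqP; rewrite -order_dvdn -oA order_dvdG ?fA.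
Qed.

(* [K] is the last term of the chief series not containing [P]. *)
Lemma partial_Pi_p_index (gT : finGroupType) (p : nat) (G P C : {group gT}) :
    P <| G -> p.-group P -> P :!=: 1 -> C \subset P -> partial_Pi_property G C ->
  exists2 K : {group gT}, K <| G /\ ~~ (P \subset K) & p.-nat #|G : 'N_G(C <*> K)|.
Proof.
move=> nsPG pP ntP sCP [s [chs lasts idx]].
pose i := find (fun L : {group gT} => P \subset L) s.
have hasP : has (fun L : {group gT} => P \subset L) s.
  case/lastP: s lasts {chs idx i} => [/= G1|s L].
    by case/negP: ntP; rewrite -subG1; move: (normal_sub nsPG); rewrite -G1.
  by rewrite last_rcons has_rcons => ->; rewrite normal_sub.
have ltis : i < size s by rewrite -has_find.
have := idx i ltis; set K := nth _ _ _; set L := nth _ _ _ => /= idxX.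
have chKL : chief_factor G K L by move/pathP: chs; apply.
have sPL : P \subset L by apply: (nth_find 1%G hasP).
have sPK : ~~ (P \subset K).
  rewrite /K; case def_i: i ltis => [|j] ltjs /=; first by rewrite subG1.
  by apply/negbT/(@before_find _ 1%G (fun L : {group gT} => P \subset L)); rewrite -/i def_i.
have [maxK nsLG] := andP chKL.
have [/andP[/proper_sub sKL nKG] _] := maxgroupP maxK.
have nsKG : K <| G by rewrite /normal nKG (subset_trans sKL) ?normal_sub.
exists K => //.
have nKC : C \subset 'N(K) by rewrite (subset_trans sCP) // (subset_trans sPL) // (subset_trans (normal_sub nsLG)).
(* As [C] lies in [P], hence in [L], the intersection is all of [C <*> K / K], a p-group, so the
   index of its normaliser is a power of [p]. *)
have defX : (C * K / K) :&: (L / K) = C <*> K / K.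
  rewrite quotientMidr quotientYidr // (setIidPl _) // quotientS //.
  exact: subset_trans sPL.
rewrite defX in idxX.
have pX : p.-group (C <*> K / K).
  by rewrite quotientYidr // quotient_pgroup // (pgroupS sCP).
have nsKCK : K <| C <*> K by rewrite normalYr.
have sKM : K \subset 'N_G(C <*> K).
  by rewrite subsetI (normal_sub nsKG) (subset_trans _ (normG _)) ?joing_subr.
have -> : #|G : 'N_G(C <*> K)| = #|G / K : 'N_(G / K)(C <*> K / K)|.
  rewrite -(quotient_subnormG _ nsKCK) index_quotient_eq ?subsetIl //.
  exact: subset_trans (subsetIr _ _) sKM.
apply: sub_in_pnat idxX => q _; rewrite mem_primes => /and3P[q_pr _ dvq].
exact: (pgroupP pX).
Qed.

Lemma pi_residual_cent (gT : finGroupType) (p : nat) (G P : {group gT}) :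
    prime p -> P <| G -> p.-group P ->
    (forall C : {group gT}, C \subset P -> cyclic C ->
       prime #|C| \/ (#|C| = 4 /\ ~ quaternion_free P) ->
       partial_Pi_property G C) ->
  P \subset 'C(pi_elt_gen p^' (abelian_exp_res p.-1 G)).
Proof.
move=> p_pr; have [n] := ubnP #|P|; elim: n P => // n IHn P leP nsPG pP HP.
set D := abelian_exp_res p.-1 G; set E := pi_elt_gen p^' D.
have [[sPG nPG] [sDG nDG]] := (andP nsPG, andP (abelian_exp_res_normal p.-1 G)).
have [sEG nEG] := andP (pi_elt_gen_normal p^' (abelian_exp_res_normal p.-1 G)).
have nPE : E \subset 'N(P) := subset_trans sEG nPG.
apply/idPn => nCPE.
pose N := 'C_P(E)%G; have sNP : N \subset P := subsetIl _ _.
have cNE : E \subset 'C(N) by rewrite centsC subsetIr.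
have nNG : G \subset 'N(N) by rewrite normsI ?norms_cent.
have nsNG : N <| G by rewrite /normal nNG (subset_trans sNP).
have maxN (R : {group gT}) : R <| G -> R \subset P -> R :!=: P -> R \subset N.
  move=> nsRG sRP neRP; rewrite subsetI sRP; apply: IHn => //.
  - by rewrite -ltnS (leq_trans _ leP) // ltnS proper_card // properEneq neRP.
  - exact: pgroupS pP.
  move=> C sCR cycC oC; apply: HP => //; first exact: subset_trans sRP.
  (* Quaternion-freeness passes from [P] to [R], so the subgroups of order 4 to be tested in [R] are
     among those tested in [P]. *)
  case: oC => [|[oC nqf]]; [by left | right; split=> // qfP; apply: nqf].
  by move=> H K sHR; apply: qfP; apply: subset_trans sRP.
have ntP : P :!=: 1 by apply: contraNneq nCPE => ->; apply: sub1G.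
(* If proper, [[~: P, E]] would lie in [N], and [pgroup_cent_pi_elt_gen] would make [E] centralise
   [P]. *)
have defP : [~: P, E] = P.
  apply/eqP/idPn=> neRP; case/negP: nCPE; apply: pgroup_cent_pi_elt_gen => //.
  apply: subset_trans (subsetIr P _); apply: (maxN [~: P, E]%G) => //.
    by rewrite /normal normsR // (subset_trans _ sPG) // commg_subl.
  by rewrite commg_subl.
have cPN : P \subset 'C(N).
  apply/commG1P; rewrite -{1}defP.
  have EN : [~: E, N] = 1 by apply/commG1P.
  apply: three_subgroup; first by rewrite EN comm1G.
  apply/trivgP; rewrite -EN [[~: E, N]]commGC commSg // commg_subl.
  exact: subset_trans sPG nNG.
have sNZ : N \subset 'Z(P) by rewrite subsetI sNP centsC.
have sPhiN : 'Phi(P) \subset N.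
  apply: (maxN 'Phi(P)%G); rewrite ?Phi_sub //.
    exact: char_normal_trans (Phi_char P) nsPG.
  by have := Phi_proper ntP; rewrite properEneq => /andP[].
have [sP'N powN] : P^`(1) \subset N /\ {in P, forall x, x ^+ p \in N}.
  move: sPhiN; rewrite (Phi_joing pP) join_subG => /andP[-> sMN]; split=> // x Px.
  by rewrite (subsetP sMN) // (Mho_p_elt 1 Px) ?(mem_p_elt pP).
have okC x : x \in P -> x != 1 -> prime #[x] \/ (#[x] = 4 /\ ~ quaternion_free P).
  move=> Px ntx; have expP := class2_expg_eq1 defP sNZ cNE sP'N powN.
  have [p2|p_odd] := even_prime p_pr; last first.
    left; rewrite (nt_prime_order p_pr _ ntx) // expP //; right.
    by rewrite prime_dvd_bin // odd_prime_gt2.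
  subst p.
  (* Only finitely many pairs of subgroups occur, so [quaternion_free P] is decided by its boolean
     form. *)
  have [/forallP qf | nqf] := boolP [forall H : {group gT}, [forall K : {group gT},
      (H \subset P) ==> (K <| H) ==> ~~ (H / K \isog 'Q_8)]].
    have qfP : quaternion_free P.
      move=> H K sHP nsKH isoQ; have /forallP/(_ K) := qf H.
      by rewrite sHP nsKH isoQ.
    have abP := quaternion_free_abelian pP defP sNZ cNE sP'N powN qfP.
    by left; rewrite (nt_prime_order p_pr _ ntx) // expP //; left.
  have nqfP : ~ quaternion_free P.
    move=> qfP; case/negP: nqf; apply/forallP=> H; apply/forallP=> K.
    by apply/implyP=> sHP; apply/implyP=> nsKH; apply/negP/qfP.
  have: #[x] %| 2 ^ 2 by rewrite order_dvdn expP //; right.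
  case/(dvdn_pfactor _ 2 p_pr) => [[|[|[|m]]]] // _ ox.
  - by case/negP: ntx; rewrite -order_eq1 ox.
  - by left; rewrite ox.
  by right; rewrite ox.
have [S sylS] := Sylow_exists p G; have [sSG pS _] := and3P sylS.
have sPS : P \subset S := normal_sub_max_pgroup (Hall_max sylS) pP nsPG.
have nNS := subset_trans sSG nNG.
have nNP := subset_trans sPG nNG.
have ltNP : ~~ (P \subset N) by rewrite subsetI subxx.
(* [P / N] is a nontrivial normal subgroup of the p-group [S / N], so it meets the centre. *)
have [x [Px notNx cSx]] : exists x, [/\ x \in P, x \notin N & coset N x \in 'Z(S / N)].
  have ntPN : P / N != 1 by rewrite -subG1 quotient_sub1.
  have nsPN : P / N <| S / N by rewrite quotient_normal // (normalS sPS sSG).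
  have := meet_center_nil (pgroup_nil (quotient_pgroup N pS)) nsPN ntPN.
  case/trivgPn=> _ /setIP[/morphimP[x nNx Px ->] Zx] ntx.
  by exists x; split=> //; apply: contra ntx => Nx; rewrite /= coset_id.
have ntx : x != 1 by apply: contraNneq notNx => ->.
have sxP : <[x]> \subset P by rewrite cycle_subG.
have [K [nsKG sPK] pM] : exists2 K : {group gT},
    K <| G /\ ~~ (P \subset K) & p.-nat #|G : 'N_G(<[x]> <*> K)|.
  apply: (partial_Pi_p_index nsPG pP ntP sxP); apply: HP => //.
    exact: cycle_cyclic.
  exact: okC.
have nNx : <[x]> \subset 'N(N) := subset_trans sxP nNP.
have [_ nKG] := andP nsKG.
pose V := (<[x]> <*> N)%G.
have sVP : V \subset P by rewrite join_subG sxP.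
have nVS : S \subset 'N(V).
  have nsNV : N <| V by rewrite normalYr.
  rewrite -(quotientSGK nNS (subset_trans (normal_sub nsNV) (normG V))).
  rewrite quotient_normG // quotientYidr // quotient_cycle ?(subsetP nNP) //.
  apply/cents_norm; rewrite centsC cycle_subG.
  by case/setIP: cSx.
(* [P :&: K] is normal in [G] and proper in [P], so it lies in [N]; Dedekind's law then rewrites [V]
   in terms of [<[x]> <*> K], [P] and [N], all normalised by the left-hand side. *)
have nVM : 'N_G(<[x]> <*> K) \subset 'N(V).
  have sKN : P :&: K \subset N.
    apply: (maxN (P :&: K)%G); rewrite ?subsetIl ?normalI //.
    by apply: contra sPK => /eqP <-; apply: subsetIr.
  have -> : V = ((<[x]> <*> K) :&: P) <*> N :> {set gT}.
    apply/eqP; rewrite eqEsubset !join_subG !joing_subr andbT; apply/and3P; split=> //.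
      by rewrite (subset_trans _ (joing_subl _ _)) // subsetI joing_subl.
    rewrite norm_joinEl ?(subset_trans sxP) ?(subset_trans sPG) //.
    rewrite -group_modl // mul_subG ?joing_subl // setIC.
    by rewrite (subset_trans sKN) ?joing_subr.
  rewrite normsY ?(subset_trans (subsetIl _ _) nNG) //.
  by rewrite normsI ?subsetIr ?(subset_trans (subsetIl _ _) nPG).
have nsVG : V <| G.
  rewrite /normal (subset_trans sVP) //.
  have sG : G \subset 'N_G(V).
    apply: (Sylow_index_sub sylS); first by rewrite subsetI sSG.
    apply: pnat_dvd pM; apply: indexgS; rewrite subsetI subsetIl //.
  by apply: subset_trans sG (subsetIr _ _).
have defV : V :=: P.
  apply/eqP; apply: contraR notNx => neVP; have := maxN V nsVG sVP neVP.
  by rewrite join_subG cycle_subG => /andP[].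
have oPN : #|P / N| = p.
  rewrite -defV quotientYidr // quotient_cycle ?(subsetP nNP) // -orderE.
  apply: nt_prime_order => //; first by rewrite -morphX ?(subsetP nNP) //= coset_id ?powN.
  by apply: contra notNx => /eqP; apply: coset_idr; rewrite (subsetP nNP).
have cDPN := abelian_exp_res_cent_prime nsNG nsPG p_pr oPN.
case/negP: ltNP; rewrite -{1}defP commGC.
rewrite -quotient_cents2 ?(subset_trans sEG) //.
exact: subset_trans (quotientS N (pi_elt_gen_sub _ _)) cDPN.
Qed.

Unset Implicit Arguments.

Theorem proposition1p5 (p : nat) (gT : finGroupType) (G P : {group gT})
    (p_pr : prime p) (nPG : P <| G) (pP : p.-group P)
    (HP : forall C : {group gT}, C \subset P -> cyclic C ->
       prime #|C| \/ (#|C| = 4 /\ ~ quaternion_free P) ->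
       partial_Pi_property G C) :
  P \subset U_hypercenter G.
Proof. exact: sub_U_hypercenter (pi_residual_cent p_pr nPG pP HP). Qed.
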